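(* Let $\mathbb{P}$ be a multiplicative subsemigroup of $\mathbb{N}=\{1,2,3,\dots\}$ with $\mathbb{P}\not\subseteq\{1\}$, and let $\mathbf{C}_{\mathbb{P}}$ be the class of all $\mathbb{P}$-torsion-free cones. Let $M$ be simply $\mathbf{C}_{\mathbb{P}}$-strongly unitarily closed. Then $M$ is a quasi-divisible refinement cone.
   Context: Commutative monoids are written additively. The algebraic preordering of a commutative monoid $M$ is $x\le y\iff(\exists z\in M)(x+z=y)$. A cone is a commutative monoid that is conical: $x+y=0\Rightarrow x=y=0$. A commutative monoid is $\mathbb{P}$-torsion-free if for all $p\in\mathbb{P}$, $px=py\Rightarrow x=y$. It is quasi-divisible if for every $x$ there are $u,v$ with $2u+3v=x$. An order-unit of $M$ is $u\in M$ such that every $x\in M$ satisfies $x\le nu$ for some positive integer $n$. $M$ is simple if every $u\in M$ with $u\not\le 0$ is an order-unit of $M$. A refinement cone is a cone with the refinement property: whenever $a_0+a_1=b_0+b_1$ there are $c_{ij}$ ($i,j<2$) with $a_i=c_{i0}+c_{i1}$ and $b_i=c_{0i}+c_{1i}$ for all $i<2$. If $A$ is a submonoid of a commutative monoid $B$, then $B$ is a strong unitary extension of $A$ if: $A$ is cofinal in $B$ (every $b\in B$ satisfies $b\le a$ in $B$ for some $a\in A$); for all $a_0,a_1\in A$ and $b\in B$, $a_0+b=a_1$ implies $b\in A$; and for all $m\in\mathbb{N}$ and $b\in B$, $mb\in A$ implies $b\in A$. An equation system with parameters from $M$ is a finite set of equations, each of the form $\sum_{i<k}p_i\mathbf{x}_i+a=\sum_{i<k}q_i\mathbf{x}_i+b$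 with $k,p_i,q_i$ non-negative integers, $a,b\in M$, and $\mathbf{x}_i$ unknowns. A simple element $M$ of $\mathbf{C}_{\mathbb{P}}$ is simply $\mathbf{C}_{\mathbb{P}}$-strongly unitarily closed if every equation system with parameters from $M$ that has a solution in some strong unitary extension of $M$ that is simple and belongs to $\mathbf{C}_{\mathbb{P}}$ has a solution in $M$. *)

(* Defs.v *)
From Stdlib Require List.
From mathcomp Require Import all_boot all_algebra.

Set Implicit Arguments.
Unset Strict Implicit.
Unset Printing Implicit Defensive.

Import GRing.Theory.

Local Open Scope ring_scope.

(* Commutative monoids are [nmodType]s; [x *+ n] is the multiple nx.  The
   [choiceType] structure that [nmodType] carries is not a mathematical
   restriction: classically, every type has one. *)

Section Monoids.

Variable M : nmodType.

Definition alg_le (x y : M) : Prop := exists z : M, x + z = y.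

Definition conical : Prop :=
  forall x y : M, x + y = 0 -> x = 0 /\ y = 0.

Definition torsion_free (P : nat -> Prop) : Prop :=
  forall p : nat, P p -> forall x y : M, x *+ p = y *+ p -> x = y.

Definition torsion_free_cone (P : nat -> Prop) : Prop :=
  conical /\ torsion_free P.

Definition quasi_divisible : Prop :=
  forall x : M, exists u v : M, u *+ 2 + v *+ 3 = x.

Definition order_unit (u : M) : Prop :=
  forall x : M, exists n : nat, (0 < n)%N /\ alg_le x (u *+ n).

Definition simple_monoid : Prop :=
  forall u : M, ~ alg_le u 0 -> order_unit u.

Definition refinement : Prop :=
  forall a0 a1 b0 b1 : M, a0 + a1 = b0 + b1 ->
  exists c00 c01 c10 c11 : M,
    [/\ a0 = c00 + c01, a1 = c10 + c11, b0 = c00 + c10 & b1 = c01 + c11].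

Definition refinement_cone : Prop := conical /\ refinement.

End Monoids.

(* For a submonoid A of B, given as a predicate. *)
Definition strong_unitary (B : nmodType) (A : B -> Prop) : Prop :=
  [/\ forall b : B, exists a : B, A a /\ alg_le b a,
      forall a0 a1 b : B, A a0 -> A a1 -> a0 + b = a1 -> A b
    & forall (m : nat) (b : B), (0 < m)%N -> A (b *+ m) -> A b].

(* An extension of M is a monoid B with an injective homomorphism f : M -> B,
   M being identified with the submonoid f(M) of B. *)
Definition strong_unitary_extension (M B : nmodType) (f : {additive M -> B}) :
  Prop := injective f /\ strong_unitary (fun b : B => exists a : M, b = f a).

(* The equation sum_(i < k) p_i x_i + a = sum_(i < k) q_i x_i + b.  The
   unknowns x_0, x_1, ... are shared by all the equations of a system. *)
Record equation (M : nmodType) := Equation {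
  eq_arity : nat;
  eq_p : 'I_eq_arity -> nat;
  eq_a : M;
  eq_q : 'I_eq_arity -> nat;
  eq_b : M
}.

Definition solves_equation (M B : nmodType) (f : M -> B) (x : nat -> B)
    (e : equation M) : Prop :=
  \sum_(i < eq_arity e) x i *+ eq_p i + f (eq_a e) =
  \sum_(i < eq_arity e) x i *+ eq_q i + f (eq_b e).

(* Solvability in B, the parameters being transported to B along f. *)
Definition has_solution (M B : nmodType) (f : M -> B) (S : seq (equation M)) :
  Prop := exists x : nat -> B, forall e, List.In e S -> solves_equation f x e.

Definition simply_strongly_unitarily_closed (P : nat -> Prop) (M : nmodType) :
    Prop :=
  [/\ simple_monoid M, torsion_free_cone M P
    & forall (S : seq (equation M)) (B : nmodType) (f : {additive M -> B}),
        strong_unitary_extension f -> simple_monoid B ->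
        torsion_free_cone B P ->
        has_solution f S -> has_solution (@id M) S].

Definition multiplicative_subsemigroup (P : nat -> Prop) : Prop :=
  (forall p, P p -> (0 < p)%N) /\ (forall p q, P p -> P q -> P (p * q)%N).

(* Main.v *)
(** A simple P-torsion-free cone M either is an abelian group with a new zero
    adjoined, where both conclusions are immediate, or is cancellative.  In the
    cancellative case let H = G x Zt, where G is the Grothendieck group of M.
    The equation 2u + 3v = x is solved in H by u = 3t - x and v = x - 2t, and a
    refinement of a0 + a1 = b0 + b1 is given by t, a0 - t, b0 - t, t + b1 - a0.
    The submonoid generated by M and these solutions is a strong unitary
    extension of M, but it is not simple.  To make it simple, fix e <> 0 in M
    and a large K, and let B consist of all d + m - (ceil(n / K) - 1) e, where m
    is in M and d is a sum of n solutions.  Every such sum d that lies in G is a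
    sum of elements of M large enough to absorb the subtracted multiple of e, so
    that B meets G only in M.  On the other hand a high multiple of a nonzero
    element of B exceeds any multiple of e, so that B is simple.  Since M is
    closed, the solutions in B yield solutions in M. *)

Require Import Defs.
From mathcomp Require Import all_boot all_algebra.
From HB Require Import structures.
From mathcomp Require Import boolp zify.

Set Implicit Arguments.
Unset Strict Implicit.
Unset Printing Implicit Defensive.

Import GRing.Theory Num.Theory.
Local Open Scope ring_scope.
Local Open Scope quotient_scope.

(** * Grothendieck groups and submonoids *)

Section GrothendieckGroup.

Variable M : nmodType.
Hypothesis addMI : left_injective (@GRing.add M).

(** The pair [(a, b)] stands for the formal difference a - b. *)
Definition groth_rel (x y : M * M) := x.1 + y.2 == y.1 + x.2.

Lemma groth_rel_refl : reflexive groth_rel.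
Proof. by move=> x; rewrite /groth_rel. Qed.

Lemma groth_rel_sym : symmetric groth_rel.
Proof. by move=> x y; rewrite /groth_rel eq_sym. Qed.

Lemma groth_rel_trans : transitive groth_rel.
Proof.
move=> y x z /eqP xy /eqP yz; apply/eqP/(@addMI y.2).
by rewrite addrAC xy addrAC yz addrAC.
Qed.

Canonical groth_equiv :=
  EquivRel groth_rel groth_rel_refl groth_rel_sym groth_rel_trans.

Definition groth := {eq_quot groth_rel}.

HB.instance Definition _ : EqQuotient _ groth_rel groth := EqQuotient.on groth.
HB.instance Definition _ := Choice.on groth.

Definition groth_add := lift_op2 groth (fun x y : M * M => x + y).

Lemma pi_groth_add : {morph \pi : x y / x + y >-> groth_add x y}.
Proof.
move=> x y; unlock groth_add; apply/eqmodP; rewrite /= /groth_rel /=.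
have/eqmodP/eqP /= hx := reprK (\pi_groth x).
have/eqmodP/eqP /= hy := reprK (\pi_groth y).
apply/eqP; rewrite addrACA [RHS]addrACA.
exact: congr2 (esym hx) (esym hy).
Qed.
Canonical pi_groth_add_morph := PiMorph2 pi_groth_add.

Definition groth_opp := lift_op1 groth (fun x : M * M => (x.2, x.1)).

Lemma pi_groth_opp : {morph \pi : x / (x.2, x.1) >-> groth_opp x}.
Proof.
move=> x; unlock groth_opp; apply/eqmodP; rewrite /= /groth_rel /=.
have/eqmodP/eqP /= hx := reprK (\pi_groth x).
apply/eqP; rewrite addrC [RHS]addrC; exact: hx.
Qed.
Canonical pi_groth_opp_morph := PiMorph1 pi_groth_opp.

Definition groth_zero := lift_cst groth (0 : M * M).
Canonical pi_groth_zero_morph := PiConst groth_zero.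

Lemma groth_addA : associative groth_add.
Proof.
elim/quotW=> x; elim/quotW=> y; elim/quotW=> z; rewrite !piE.
by rewrite addrA.
Qed.

Lemma groth_addC : commutative groth_add.
Proof. by elim/quotW=> x; elim/quotW=> y; rewrite !piE addrC. Qed.

Lemma groth_add0 : left_id groth_zero groth_add.
Proof. by elim/quotW=> x; rewrite !piE add0r. Qed.

Lemma groth_addN : left_inverse groth_zero groth_opp groth_add.
Proof.
elim/quotW=> x; rewrite !piE; apply/eqmodP.
by rewrite /= /groth_rel /= addr0 add0r addrC.
Qed.

HB.instance Definition _ := GRing.isZmodule.Build groth
  groth_addA groth_addC groth_add0 groth_addN.

Lemma grothendieck_group : exists (G : zmodType) (i : {additive M -> G}),
  injective i /\ forall g, exists a b, g + i b = i a.
Proof.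
have piD (x y : M * M) : \pi_groth x + \pi_groth y = \pi_groth (x + y).
  by rewrite [LHS]/GRing.add /= !piE.
pose i (a : M) : groth := \pi_groth (a, 0).
have iD : GRing.nmod_morphism i.
  split; first by rewrite /i [RHS]/GRing.zero /= !piE.
  by move=> a b; rewrite /i piD; congr (\pi_groth (_, _)); rewrite addr0.
pose iM := GRing.isNmodMorphism.Build _ _ i iD.
exists groth, (HB.pack i iM : {additive M -> groth}); split => /=.
  by move=> a b /eqmodP/eqP /=; rewrite !addr0.
elim/quotW=> -[a b]; exists a, b.
by rewrite /= /i piD; apply/eqmodP/eqP => /=; rewrite !addr0.
Qed.

End GrothendieckGroup.

(** Take H = G x Z with [deg] the second projection and t = (0, 1). Then t is free over G, and
    degree 0 singles out the differences of elements of M. *)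
Lemma graded_group (M : nmodType) : left_injective (@GRing.add M) ->
  exists (H : zmodType) (i : {additive M -> H}) (deg : {additive H -> int})
    (t : H),
  [/\ injective i, deg t = 1
    & forall h, deg h = 0 <-> exists a b, h + i b = i a].
Proof.
move=> addMI; have [G [j [j_inj jG]]] := grothendieck_group addMI.
pose H : zmodType := (G * int)%type.
pose i (a : M) : H := (j a, 0).
have iD : GRing.nmod_morphism i.
  split; first by rewrite /i raddf0.
  by move=> a b; rewrite /i raddfD; congr (_, _).
pose iM := GRing.isNmodMorphism.Build _ _ i iD.
exists H, (HB.pack i iM : {additive M -> H}), snd, (0, 1); split => //=.
  by move=> a b [] /j_inj.
move=> [g n] /=; split=> [->|[a [b]]].
  have [a [b gE]] := jG g; exists a, b.
  by apply: injective_projections; rewrite /= ?addr0.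
by case=> _; rewrite addr0.
Qed.

Section Submonoid.

Variables (H : nmodType) (Q : H -> Prop).
Hypotheses (Q0 : Q 0) (QD : forall x y, Q x -> Q y -> Q (x + y)).

Definition submonoid_pred : {pred H} := fun x => `[< Q x >].

Lemma submonoid_closed : GRing.nmod_closed submonoid_pred.
Proof.
split=> [|x y]; first exact/asboolP.
by move=> /asboolP Qx /asboolP Qy; apply/asboolP/QD.
Qed.

Definition submonoid := {x : H | submonoid_pred x}.

HB.instance Definition _ := [isSub of submonoid for sval].
HB.instance Definition _ := [Choice of submonoid by <:].
HB.instance Definition _ :=
  GRing.SubChoice_isSubNmodule.Build H submonoid_pred submonoid
    submonoid_closed.

Lemma submonoid_exists : exists (B : nmodType) (v : {additive B -> H}),
  injective v /\ forall h, Q h <-> exists b, v b = h.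
Proof.
exists submonoid, val; split; first exact: val_inj.
move=> h; split=> [Qh|[b <-]]; last exact/asboolP/(valP b).
by exists (Sub h (asboolT Qh)).
Qed.

End Submonoid.

Lemma lift_additive (M B H : nmodType) (v : {additive B -> H})
    (i : {additive M -> H}) :
  injective v -> (forall m, exists b, v b = i m) ->
  exists f : {additive M -> B}, forall m, v (f m) = i m.
Proof.
move=> v_inj /choice[f fE].
have fD : GRing.nmod_morphism f.
  by split=> [|x y]; apply: v_inj; rewrite ?raddfD !fE ?raddf0 ?raddfD.
pose fM := GRing.isNmodMorphism.Build _ _ f fD.
by exists (HB.pack f fM : {additive M -> B}).
Qed.

(** * Simple cones *)

Lemma mulrn_conical_eq0 (M : nmodType) (x : M) n :
  conical M -> (0 < n)%N -> x *+ n = 0 -> x = 0.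
Proof. by move=> cM; case: n => // n _; rewrite mulrS => /cM[]. Qed.

Lemma simple_alg_le (M : nmodType) (x y : M) : conical M -> simple_monoid M ->
  x <> 0 -> exists2 n, (0 < n)%N & exists z, y + z = x *+ n.
Proof.
move=> cM sM x0; have [[z xz]|n [n0 le]] := sM x _ y; last by exists n.
by case: x0; have [] := cM _ _ xz.
Qed.

Lemma torsion_free_exp (M : nmodType) (P : nat -> Prop) p (x y : M) k :
  torsion_free M P -> P p -> x *+ (p ^ k) = y *+ (p ^ k) -> x = y.
Proof.
move=> tM Pp; elim: k => [|k IH]; first by rewrite !mulr1n.
by rewrite expnSr !mulrnA => /(tM p Pp)/IH.
Qed.

Section SimpleCones.

Variables (P : nat -> Prop) (p : nat) (M : nmodType).
Hypotheses (Pp : P p) (p1 : (1 < p)%N).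
Hypotheses (sM : simple_monoid M) (cM : conical M) (tM : torsion_free M P).

(** The equation iterates to kx + z = ky + z for all k. By simplicity z lies below a multiple of x
    and below a multiple of y, so z can be traded for these multiples; torsion-freeness then gives x
    = y. *)
Lemma nonzero_addIr (x y z : M) :
  x <> 0 -> y <> 0 -> x + z = y + z -> x = y.
Proof.
move=> x0 y0 xyz.
have kxyz k : x *+ k + z = y *+ k + z.
  by elim: k => // k IH; rewrite !mulrSr -addrA xyz addrCA IH addrCA addrA.
have [n n0 [w zw]] := simple_alg_le z cM sM x0.
have [n' n'0 [w' zw']] := simple_alg_le z cM sM y0.
have kx k : x *+ (k + n) = y *+ k + x *+ n.
  by rewrite mulrnDr -zw !addrA kxyz.
have ky k : y *+ (k + n') = x *+ k + y *+ n'.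
  by rewrite mulrnDr -zw' !addrA kxyz.
(* The exponent only has to make the power of p at least n + n'. Both sides become ry + n'y + nx. *)
apply: (torsion_free_exp (k := n + n') tM Pp).
have /subnKC <- : (n + n' <= p ^ (n + n'))%N by exact/ltnW/ltn_expl.
set r := (_ - _)%N; rewrite (_ : n + n' + r = r + n' + n)%N; last by lia.
rewrite kx (_ : r + n' + n = r + (n + n'))%N; last by lia.
by rewrite mulrnDr [RHS]mulrnDr ky -addrA [_ + x *+ n]addrC.
Qed.

(* In the second case M is an abelian group, with neutral element [u], to which
   a new zero has been adjoined. *)
Lemma simple_cone_cases : left_injective (@GRing.add M) \/
  exists u : M, (forall y, y <> 0 -> u + y = y) /\
                (forall y, y <> 0 -> exists y', y + y' = u).
Proof.
have [addMI|] := pselect (left_injective (@GRing.add M)); first by left.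
move=> /existsNP[z /existsNP[x /existsNP[y /not_implyP[xyz xy]]]]; right.
(* By [nonzero_addIr], cancellation can fail only if x or y is 0; the other one is then absorbed by
   z. *)
have [u [u0 uz]] : exists u : M, u <> 0 /\ u + z = z.
  have [x0|/eqP x0] := eqVneq x 0.
    exists y; rewrite -xyz x0 add0r; split=> // y0.
    by rewrite x0 y0 in xy.
  have [y0|/eqP y0] := eqVneq y 0; last by case: xy; exact: nonzero_addIr xyz.
  by exists x; split=> //; rewrite xyz y0 add0r.
have uN y' : y' <> 0 -> u + y' = y'.
  move=> y'0; apply: (@nonzero_addIr _ _ z) => //; first by move=> /cM[].
  by rewrite addrAC uz addrC.
exists u; split=> // y' y'0.
(* Since u + u = u, the multiple nu is u itself, so w is an inverse of y'. *)
have [n n0 [w y'w]] := simple_alg_le y' cM sM u0.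
exists w; rewrite y'w; elim: n n0 {y'w} => // -[|n] IH _ //.
by rewrite mulrS IH // uN.
Qed.

End SimpleCones.

Lemma refinement_nonzero (M : nmodType) :
  (forall a0 a1 b0 b1 : M, a0 <> 0 -> a1 <> 0 -> b0 <> 0 -> b1 <> 0 ->
    a0 + a1 = b0 + b1 -> exists c00 c01 c10 c11 : M,
    [/\ a0 = c00 + c01, a1 = c10 + c11, b0 = c00 + c10 & b1 = c01 + c11]) ->
  refinement M.
Proof.
move=> IH a0 a1 b0 b1 ab.
have [a00|/eqP a00] := eqVneq a0 0.
  by exists 0, 0, b0, b1; split; rewrite ?addr0 ?add0r // -ab a00 add0r.
have [a10|/eqP a10] := eqVneq a1 0.
  by exists b0, b1, 0, 0; split; rewrite ?addr0 ?add0r // -ab a10 addr0.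
have [b00|/eqP b00] := eqVneq b0 0.
  by exists 0, a0, 0, a1; split; rewrite ?addr0 ?add0r // ab b00 add0r.
have [b10|/eqP b10] := eqVneq b1 0.
  by exists a0, 0, a1, 0; split; rewrite ?addr0 ?add0r // ab b10 addr0.
exact: IH.
Qed.

(** * Simple strong unitary extensions *)

(* This is ceil(n / K) - 1 for n > 0, and 0 for n = 0. *)
Definition quot_pred (K n : nat) : nat := n.-1 %/ K.

(** This is what makes [ext_pred] stable under addition. *)
Lemma quot_pred_superadditive K m n :
  (quot_pred K m + quot_pred K n <= quot_pred K (m + n))%N.
Proof.
rewrite /quot_pred; case: K => [|K]; first by rewrite !divn0.
rewrite leq_divRL // mulnDl.
by have := leq_trunc_div m.-1 K.+1; have := leq_trunc_div n.-1 K.+1; lia.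
Qed.

(** Write q for [quot_pred K n] and N for Kk + 1. Rounding leaves Kq + 1 <= n, hence Nn - 1 >= K(Nq
    + k): the spare unit, taken N times, pays for k more copies of K. *)
Lemma quot_pred_mul K n k : (0 < K)%N -> (0 < n)%N ->
  ((K * k).+1 * quot_pred K n + k <= quot_pred K ((K * k).+1 * n))%N.
Proof.
rewrite /quot_pred => K0 n0; rewrite leq_divRL //.
have := leq_trunc_div n.-1 K; move: (n.-1 %/ K)%N => q; nia.
Qed.

(* [D n d] is to be read: d is a sum of n of the elements of H that are to be
   adjoined to M.  [H] is an extension of the Grothendieck group of M, which is
   the kernel of [deg]. *)
Section Extension.

Variables (P : nat -> Prop) (M : nmodType) (H : zmodType).
Variables (i : {additive M -> H}) (deg : {additive H -> int}).
Variables (D : nat -> H -> Prop) (K : nat) (e : M).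

Hypotheses (hP : forall p, P p -> (0 < p)%N).
Hypotheses (sM : simple_monoid M) (cM : conical M) (tM : torsion_free M P).
Hypotheses (i_inj : injective i)
  (deg0 : forall h, deg h = 0 <-> exists a b, h + i b = i a).
Hypotheses (e0 : e <> 0) (K0 : (0 < K)%N).
Hypotheses (D00 : D 0 0) (D0 : forall d, D 0 d -> d = 0).
Hypothesis DD : forall m n c d, D m c -> D n d -> D (m + n)%N (c + d).
Hypothesis Dcofinal :
  forall n d, D n d -> exists n' d' a, D n' d' /\ d + d' = i a.
(** This is the condition that K be large: a sum d lying in G absorbs the multiple of e subtracted
    from it. That w is nonzero yields conicality. *)
Hypothesis Ddeg0 : forall n d, D n d -> (0 < n)%N -> deg d = 0 ->
  exists2 w, w <> 0 & d = i (e *+ quot_pred K n + w).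

Let q := quot_pred K.

Definition ext_pred (h : H) : Prop :=
  exists n d m, D n d /\ h + i (e *+ q n) = d + i m.

Lemma deg_i a : deg (i a) = 0.
Proof. by apply/deg0; exists a, 0; rewrite raddf0 addr0. Qed.

Lemma D_mulrn n d k : D n d -> D (k * n)%N (d *+ k).
Proof.
by move=> Dd; elim: k => // k IH; rewrite mulSn mulrS; exact: DD.
Qed.

Lemma q_split m n : exists k, q (m + n) = (q m + q n + k)%N.
Proof.
by exists (q (m + n) - (q m + q n))%N; rewrite subnKC ?quot_pred_superadditive.
Qed.

Lemma ext_pred_i m : ext_pred (i m).
Proof. by exists 0, 0, m; rewrite /q /quot_pred div0n raddf0 addr0 add0r. Qed.

Lemma ext_pred_D n d : D n d -> ext_pred d.
Proof. by move=> Dd; exists n, d, (e *+ q n). Qed.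

Lemma ext_predD x y : ext_pred x -> ext_pred y -> ext_pred (x + y).
Proof.
move=> [n [d [m [Dd xE]]]] [n' [d' [m' [Dd' yE]]]].
have [k qE] := q_split n n'.
exists (n + n')%N, (d + d'), (m + m' + e *+ k); split; first exact: DD.
rewrite qE !mulrnDr !raddfD /= addrA [RHS]addrA; congr (_ + _).
by rewrite addrACA xE yE addrACA.
Qed.

(** Since M has degree 0, the part d of h has degree 0 as well, and [Ddeg0] applies to it. *)
Lemma ext_pred_deg0 h : ext_pred h -> deg h = 0 -> exists m, h = i m.
Proof.
move=> [n [d [m [Dd hE]]]] h0.
have d0 : deg d = 0.
  by have := congr1 deg hE; rewrite !raddfD /= !deg_i h0 !addr0.
case: n => [|n] in Dd hE *; last first.
  have [w _ dE] := Ddeg0 Dd isT d0; exists (w + m).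
  apply: (addIr (i (e *+ q n.+1))); rewrite hE dE -!raddfD.
  by congr (i _); rewrite -addrA addrC.
exists m; move: hE; rewrite (D0 Dd) /q /quot_pred div0n raddf0 add0r.
by rewrite addr0.
Qed.

(** If some adjoined element occurs, [Ddeg0] for d + d' and superadditivity turn x + y = 0 into a
    vanishing sum in M with the nonzero summand w. *)
Lemma ext_pred_conical x y : ext_pred x -> ext_pred y -> x + y = 0 -> x = 0.
Proof.
move=> [n [d [m [Dd xE]]]] [n' [d' [m' [Dd' yE]]]] xy0.
have dd' : d + d' + i (m + m') = i (e *+ (q n + q n')).
  by rewrite mulrnDr !raddfD /= addrACA -xE -yE addrACA xy0 add0r.
have [nn'0|nn'] := posnP (n + n').
  have [? ?] : n = 0%N /\ n' = 0%N by lia.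
  subst n n'; move: dd' xE; rewrite (D0 Dd) (D0 Dd') addr0 add0r.
  rewrite /q /quot_pred div0n addn0 mulr0n => /i_inj/cM[-> _].
  by rewrite !raddf0 !addr0.
have dd'0 : deg (d + d') = 0.
  by have := congr1 deg dd'; rewrite [deg (_ + i _)]raddfD !deg_i addr0.
have [w w0 dd'E] := Ddeg0 (DD Dd Dd') nn' dd'0.
have [k qE] := q_split n n'; case: w0.
move: dd'; rewrite dd'E -raddfD /= -/q qE => /i_inj.
rewrite mulrnDr -!addrA -[RHS]addr0 => /(congr1 i).
by rewrite !(raddfD i) => /addrI; rewrite -!raddfD => /i_inj/cM[_ /cM[]].
Qed.

(** If a <= ke and N = Kk + 1, then Nd permits k more copies of e to be subtracted than Nh uses,
    which makes room for a. *)
Lemma ext_pred_le h a : ext_pred h -> h <> 0 ->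
  exists2 N, (0 < N)%N & exists h', ext_pred h' /\ i a + h' = h *+ N.
Proof.
move=> [n [d [m [Dd hE]]]] h0; have [n0|n0] := posnP n.
  subst n; move: hE; rewrite (D0 Dd) /q /quot_pred div0n raddf0 add0r addr0.
  move=> hE; subst h; have m0 : m <> 0 by move=> m0; rewrite m0 raddf0 in h0.
  have [N N0 [z az]] := simple_alg_le a cM sM m0; exists N => //.
  by exists (i z); split; [exact: ext_pred_i | rewrite -raddfD az raddfMn].
have [k k0 [z az]] := simple_alg_le a cM sM e0.
pose N := (K * k).+1; exists N => //.
exists (h *+ N - i a); split; last by rewrite addrC subrK.
have qN := quot_pred_mul k K0 n0; rewrite -/N -/q in qN.
exists (N * n)%N, (d *+ N), (m *+ N + z + e *+ (q (N * n) - (N * q n + k))).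
split; first exact: D_mulrn.
have hN : h *+ N + i (e *+ (N * q n)) = d *+ N + i (m *+ N).
  by rewrite [(N * _)%N]mulnC mulrnA !(raddfMn i N) -!mulrnDl hE.
rewrite addrAC; apply/eqP; rewrite subr_eq; apply/eqP.
rewrite -[in LHS](subnKC qN) 2!mulrnDr -az !(raddfD i) !addrA hN -!addrA.
by do 2 congr (_ + _); rewrite addrC -addrA.
Qed.

Lemma ext_pred_cofinal h : ext_pred h ->
  exists a h', ext_pred h' /\ h + h' = i a.
Proof.
move=> [n [d [m [Dd hE]]]]; have [n' [d' [a [Dd' dd'E]]]] := Dcofinal Dd.
exists (a + m), (d' + i (e *+ q n)); split.
  by apply: ext_predD (ext_pred_i _); exact: ext_pred_D Dd'.
by rewrite addrCA hE addrA [d' + d]addrC dd'E raddfD.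
Qed.

(** A p-torsion element of H has degree 0, so it is a difference of elements of M. *)
Lemma group_torsion_free p (x y : H) : P p -> x *+ p = y *+ p -> x = y.
Proof.
move=> Pp xy; have p0 := hP Pp; apply/eqP; rewrite -subr_eq0; apply/eqP.
have {xy}: (x - y) *+ p = 0 by rewrite mulrnBl xy subrr.
move: (x - y) => h hp; have : deg h *+ p = 0 by rewrite -raddfMn hp raddf0.
move/eqP; rewrite mulrn_eq0 -[p == _]negbK -lt0n p0 /= => /eqP/deg0[a [b hE]].
have := congr1 (fun x => x *+ p) hE; rewrite mulrnDl hp add0r -!raddfMn.
move=> /i_inj/(tM Pp) ba; apply: (addIr (i b)).
by rewrite hE ba add0r.
Qed.

(** B is the submonoid [ext_pred]. It meets degree 0 exactly in M, and degree 0 is inherited by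
    differences and by divisors of positive multiples: this gives unitarity. Simplicity follows by
    passing through M: x <= f a <= Nu. *)
Lemma simple_extension :
  exists (B : nmodType) (f : {additive M -> B}) (v : {additive B -> H}),
  [/\ strong_unitary_extension f, simple_monoid B & torsion_free_cone B P] /\
  [/\ injective v, forall m, v (f m) = i m
    & forall n d, D n d -> exists b, v b = d].
Proof.
have Q0 : ext_pred 0 by rewrite -(raddf0 i); exact: ext_pred_i.
have [B [v [v_inj vP]]] := submonoid_exists Q0 ext_predD.
have vQ b : ext_pred (v b) by apply/vP; exists b.
have [m|f fE] := @lift_additive _ _ _ v i v_inj; first exact/vP/ext_pred_i.
have f_le b c : b <> 0 -> exists2 N, (0 < N)%N & alg_le (f c) (b *+ N).
  move=> b0; have [|N N0 [h' [/vP[b' <-] E]]] := ext_pred_le c (vQ b).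
    by rewrite -(raddf0 v) => /v_inj.
  by exists N => //; exists b'; apply: v_inj; rewrite raddfD fE raddfMn.
have f_cofinal b : exists a, alg_le b (f a).
  have [a [h' [/vP[b' <-] E]]] := ext_pred_cofinal (vQ b).
  by exists a, b'; apply: v_inj; rewrite raddfD fE.
have f_deg b : deg (v b) = 0 -> exists a, b = f a.
  move=> /(ext_pred_deg0 (vQ b))[a E].
  by exists a; apply: v_inj; rewrite fE.
have deg_f a : deg (v (f a)) = 0 by rewrite fE deg_i.
exists B, f, v; split; last first.
  by split=> // n d Dd; apply/vP; exact: ext_pred_D Dd.
split.
- split; first by move=> a b /(congr1 v); rewrite !fE => /i_inj.
  split=> [b|_ _ b [a0 ->] [a1 ->] E|n b n0 [a E]].
  + by have [a le] := f_cofinal b; exists (f a); split=> //; exists a.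
  + apply: f_deg; have := congr1 (deg \o v) E.
    by rewrite /= !raddfD /= !deg_f add0r.
  + apply/f_deg/eqP; have /eqP := congr1 (deg \o v) E.
    by rewrite /= !raddfMn deg_f mulrn_eq0 eqn0Ngt n0.
- move=> u u0 x; have [a [x' xE]] := f_cofinal x.
  have [u00|N N0 [u' uE]] := f_le u a.
    by case: u0; exists 0; rewrite u00 addr0.
  by exists N; split=> //; exists (x' + u'); rewrite addrA xE.
- split=> [x y xy0|p Pp x y /(congr1 v)].
    have vx0 : v x = 0.
      apply: ext_pred_conical (vQ x) (vQ y) _.
      by rewrite -raddfD xy0 raddf0.
    have x0 : x = 0 by apply: v_inj; rewrite vx0 raddf0.
    by move: xy0; rewrite x0 add0r.
  by rewrite !raddfMn => /(group_torsion_free Pp)/v_inj.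
Qed.

End Extension.

(** * Closed monoids *)

Lemma multiple_exceeds (M : nmodType) (y e z r : M) K k n : conical M ->
  y <> 0 -> e + z = y *+ K -> (K * k < n)%N ->
  exists2 w, w <> 0 & y *+ n + r = e *+ k + w.
Proof.
move=> cM y0 ez Kn; exists (z *+ k + y *+ (n - K * k) + r).
  move=> /cM[/cM[_ /mulrn_conical_eq0 E] _].
  by apply: y0; apply: E => //; rewrite subn_gt0.
by rewrite -{1}(subnKC (ltnW Kn)) mulrnDr mulrnA -ez mulrnDl !addrA.
Qed.

(** This supplies [Ddeg0] for refinements. The count is doubled because each of the y's will be a
    sum of two adjoined elements. *)
Lemma sum_exceeds (M : nmodType) (y1 y2 y3 y4 e : M) : conical M ->
  simple_monoid M -> y1 <> 0 -> y2 <> 0 -> y3 <> 0 -> y4 <> 0 ->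
  exists2 K, (0 < K)%N & forall n1 n2 n3 n4, (0 < n1 + n2 + n3 + n4)%N ->
    exists2 w, w <> 0 &
      y1 *+ n1 + y2 *+ n2 + y3 *+ n3 + y4 *+ n4 =
      e *+ quot_pred K (n1 + n2 + n3 + n4).*2 + w.
Proof.
move=> cM sM y10 y20 y30 y40.
have [K1 K10 [z1 z1E]] := simple_alg_le e cM sM y10.
have [K2 K20 [z2 z2E]] := simple_alg_le e cM sM y20.
have [K3 K30 [z3 z3E]] := simple_alg_le e cM sM y30.
have [K4 K40 [z4 z4E]] := simple_alg_le e cM sM y40.
(* Pigeonhole: if every n_j were at most K_j k, the sum n of the n_j would be at most (K1 + K2 + K3
   + K4)k, whereas 8(K1 + K2 + K3 + K4)k < 2n. *)
exists (8 * (K1 + K2 + K3 + K4))%N => [|n1 n2 n3 n4 n0]; first by lia.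
rewrite /quot_pred; have := leq_trunc_div (n1 + n2 + n3 + n4).*2.-1
  (8 * (K1 + K2 + K3 + K4)).
set k := (_.-1 %/ _)%N; move: k => k kn.
have : [|| K1 * k < n1, K2 * k < n2, K3 * k < n3 | K4 * k < n4]%N.
  apply/negPn/negP; rewrite !negb_or -!leqNgt => /and4P[].
  by move: n0 kn; nia.
case/or4P => [lt|lt|lt|lt].
- rewrite -!addrA; exact: multiple_exceeds cM y10 z1E lt.
- rewrite [y1 *+ n1 + _]addrC -!addrA; exact: multiple_exceeds cM y20 z2E lt.
- rewrite [_ + y3 *+ n3]addrC -!addrA; exact: multiple_exceeds cM y30 z3E lt.
- rewrite addrC; exact: multiple_exceeds cM y40 z4E lt.
Qed.

Section Closed.

Variables (P : nat -> Prop) (M : nmodType).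
Hypotheses (hP : forall p, P p -> (0 < p)%N).
Hypotheses (hM : simply_strongly_unitarily_closed P M).
Hypotheses (addMI : left_injective (@GRing.add M)).

Let sM : simple_monoid M. Proof. by case: hM. Qed.
Let cM : conical M. Proof. by case: hM => _ []. Qed.
Let tM : torsion_free M P. Proof. by case: hM => _ []. Qed.

Lemma closed_quasi_divisible : quasi_divisible M.
Proof.
move=> x; have [->|/eqP x0] := eqVneq x 0.
  by exists 0, 0; rewrite !mul0rn addr0.
have [H [i [deg [t [i_inj degt deg0]]]]] := graded_group addMI.
have degi a : deg (i a) = 0 by apply/deg0; exists a, 0; rewrite raddf0 addr0.
pose u := t *+ 3 - i x; pose v := i x - t *+ 2.
have uv : u + v = t by rewrite /u /v addrA subrK -mulrnBr.
have uvx : u *+ 2 + v *+ 3 = i x.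
  by rewrite [v *+ 3]mulrS addrCA -mulrnDl uv subrK.
have degu : deg u = 3 by rewrite raddfB raddfMn degt degi.
have degv : deg v = -2%:Z by rewrite raddfB raddfMn degt degi.
clearbody u v.
pose D n d := exists k l, n = (k + l)%N /\ d = u *+ k + v *+ l.
(* Here e = x, and K = 5 because 2u + 3v = x uses five adjoined elements. *)
have [||||||B [f [w [[hB sB cB] [w_inj wf wD]]]]] :=
  @simple_extension P M H i deg D 5 x hP sM cM tM i_inj deg0 x0.
- by [].
- by exists 0, 0; rewrite !mulr0n addr0.
- move=> _ [k [l [kl ->]]]; have [-> ->] : k = 0%N /\ l = 0%N by lia.
  by rewrite !mulr0n addr0.
- move=> m n c d [k [l [-> ->]]] [k' [l' [-> ->]]].
  by exists (k + k')%N, (l + l')%N; rewrite addnACA !mulrnDr addrACA.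
- move=> n d [k [l [_ ->]]].
  (* This complement completes ku + lv to (k + l)(2u + 3v). *)
  exists (k + 2 * l + (3 * k + 2 * l))%N.
  exists (u *+ (k + 2 * l) + v *+ (3 * k + 2 * l)), (x *+ (k + l)).
  split; first by exists (k + 2 * l)%N, (3 * k + 2 * l)%N.
  rewrite raddfMn -uvx mulrnDl -!mulrnA addrACA -!mulrnDr.
  by congr (_ *+ _ + _ *+ _); lia.
- move=> n d [k [l [-> ->]]] kl0.
  rewrite raddfD !raddfMn degu degv => kl.
  (* Degree 0 means 3k = 2l. The sum is then jx with n = 5j, so j - 1 copies of x are subtracted and
     w = x is left over. *)
  have [j [kE lE]] : exists j, k = (2 * j)%N /\ l = (3 * j)%N.
    by exists (l %/ 3)%N; lia.
  exists x => //; rewrite kE lE !mulrnA -mulrnDl uvx -raddfMn -mulrSr.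
  by congr (i (_ *+ _)); rewrite /quot_pred; lia.
have [|bu wu] := wD 1 u; first by exists 1, 0; rewrite mulr1n addr0.
have [|bv wv] := wD 1 v; first by exists 0, 1; rewrite mulr1n add0r.
pose E : equation M := @Equation M 2
  (fun j => if val j == 0 then 2 else 3)%N 0 (fun=> 0%N) x.
have [_ _ /(_ [:: E] B f hB sB cB)] := hM.
case=> [|s sE].
  exists (fun j => if j == 0%N then bu else bv) => _ [<-|[]].
  rewrite /solves_equation /= !big_ord_recl !big_ord0 /= !raddf0.
  rewrite !addr0 !add0r.
  by apply: w_inj; rewrite raddfD !raddfMn wu wv uvx wf.
have := sE E (or_introl erefl); rewrite /solves_equation /=.
rewrite !big_ord_recl !big_ord0 /= !addr0 !add0r => sx.
by exists (s 0), (s 1%N).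
Qed.

Lemma closed_refinement : refinement M.
Proof.
apply: refinement_nonzero => a0 a1 b0 b1 a00 a10 b00 b10 ab.
have [K K0 KP] := sum_exceeds a0 cM sM a00 b00 b10 a10.
have [H [i [deg [t [i_inj degt deg0]]]]] := graded_group addMI.
have degi a : deg (i a) = 0 by apply/deg0; exists a, 0; rewrite raddf0 addr0.
have [c00 [c01 [c10 [c11 [E E' [d00 d01 d10 d11]]]]]] : exists c00 c01 c10 c11,
    [/\ c00 + c01 = i a0 /\ c10 + c11 = i a1,
        c00 + c10 = i b0 /\ c01 + c11 = i b1
      & [/\ deg c00 = 1, deg c01 = -1, deg c10 = -1 & deg c11 = 1]].
  exists t, (i a0 - t), (i b0 - t), (i b1 - (i a0 - t)).
  split; last by rewrite !(raddfB deg) !degi degt.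
    split; first by rewrite addrC subrK.
    rewrite addrACA -opprD [t + _]addrC subrK -raddfD -ab raddfD.
    by rewrite addrAC subrr add0r.
  by split; rewrite addrC subrK.
pose D n d := exists k00 k01 k10 k11, n = (k00 + k01 + (k10 + k11))%N /\
  d = c00 *+ k00 + c01 *+ k01 + (c10 *+ k10 + c11 *+ k11).
have [|||||B [f [w [[hB sB cB] [w_inj wf wD]]]]] :=
  @simple_extension P M H i deg D K a0 hP sM cM tM i_inj deg0 a00 K0.
- by exists 0, 0, 0, 0; rewrite !mulr0n !addr0.
- move=> _ [k00 [k01 [k10 [k11 [k0 ->]]]]].
  have [-> -> -> ->] : [/\ k00 = 0, k01 = 0, k10 = 0 & k11 = 0]%N.
    by split; lia.
  by rewrite !mulr0n !addr0.
- move=> m n c d [k00 [k01 [k10 [k11 [-> ->]]]]].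
  move=> [l00 [l01 [l10 [l11 [-> ->]]]]].
  exists (k00 + l00)%N, (k01 + l01)%N, (k10 + l10)%N, (k11 + l11)%N.
  split; first by lia.
  by rewrite !mulrnDr addrACA; congr (_ + _); rewrite addrACA.
- move=> n d [k00 [k01 [k10 [k11 [_ ->]]]]].
  (* Exchanging the two coefficients in each row completes the sum to a combination of the row sums
     a0 and a1. *)
  exists (k01 + k00 + (k11 + k10))%N.
  exists (c00 *+ k01 + c01 *+ k00 + (c10 *+ k11 + c11 *+ k10)).
  exists (a0 *+ (k00 + k01) + a1 *+ (k10 + k11)).
  split; first by exists k01, k00, k11, k10.
  rewrite addrACA raddfD !raddfMn -(proj1 E) -(proj2 E) !mulrnDl !mulrnDr.
  congr (_ + _); first by rewrite addrACA; congr (_ + _); rewrite addrC.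
  by rewrite addrACA; congr (_ + _); rewrite addrC.
- move=> n d [k00 [k01 [k10 [k11 [-> ->]]]]] k0.
  rewrite !raddfD !raddfMn d00 d01 d10 d11 => degk.
  (* A sum of degree 0 is a combination of row and column sums: k01 a0 + (k00 - k01) b0 + k11 a1 if
     k01 <= k00, and k00 a0 + (k01 - k00) b1 + k10 a1 otherwise. *)
  have kk : (k00 + k11 = k01 + k10)%N by lia.
  have [le|lt] := leqP k01 k00.
    have [] := KP k01 (k00 - k01)%N 0%N k11; first by lia.
    move=> x x0 xE; exists x => //.
    have <- : (k01 + (k00 - k01) + 0 + k11).*2 = (k00 + k01 + (k10 + k11))%N.
      by lia.
    rewrite -xE mulr0n addr0 !raddfD !raddfMn -(proj1 E) -(proj1 E') -(proj2 E).
    have -> : k10 = (k11 + (k00 - k01))%N by lia.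
    rewrite -{1}(subnKC le) !mulrnDl !mulrnDr.
    by rewrite [LHS](AC (3*3) ((1*3)*(2*5)*(4*6))).
  have [] := KP k00 0%N (k01 - k00)%N k10; first by lia.
  move=> x x0 xE; exists x => //.
  have <- : (k00 + 0 + (k01 - k00) + k10).*2 = (k00 + k01 + (k10 + k11))%N.
    by lia.
  rewrite -xE mulr0n addr0 !raddfD !raddfMn -(proj1 E) -(proj2 E') -(proj2 E).
  have -> : k11 = (k10 + (k01 - k00))%N by lia.
  rewrite -{1}(subnKC (ltnW lt)) !mulrnDl !mulrnDr.
  by rewrite [LHS](AC ((1*2)*(1*2)) ((1*2)*(3*6)*(4*5))).
have [|x00 w00] := wD 1 c00.
  by exists 1, 0, 0, 0; rewrite !mulr0n !addr0 mulr1n.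
have [|x01 w01] := wD 1 c01.
  by exists 0, 1, 0, 0; rewrite !mulr0n !addr0 mulr1n add0r.
have [|x10 w10] := wD 1 c10.
  by exists 0, 0, 1, 0; rewrite !mulr0n !addr0 mulr1n add0r.
have [|x11 w11] := wD 1 c11.
  by exists 0, 0, 0, 1; rewrite !mulr0n !add0r mulr1n.
(* The unknowns 0, 1, 2, 3 stand for c00, c01, c10, c11; [I] selects those whose sum is to be c. *)
pose eqn (I : pred nat) (c : M) : equation M := @Equation M 4
  (fun=> 0%N) c (fun j => I (val j) : nat) 0.
pose S := [:: eqn (fun j => j < 2)%N a0; eqn (fun j => 1 < j)%N a1;
  eqn (fun j => ~~ odd j) b0; eqn odd b1].
have eqnP (C : nmodType) (g : {additive M -> C}) s I c :
    solves_equation g s (eqn I c) <-> g c = s 0%N *+ I 0%N + (s 1%N *+ I 1%N +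
      (s 2%N *+ I 2%N + s 3%N *+ I 3%N)).
  rewrite /solves_equation /= !big_ord_recl !big_ord0 /= !raddf0.
  by rewrite !addr0 !add0r.
have [_ _ /(_ S B f hB sB cB)] := hM.
case=> [|s sE].
  exists (nth 0 [:: x00; x01; x10; x11]).
  case: E E' => [E0 E1] [E0' E1'] _ [<-|[<-|[<-|[<-|[]]]]].
  - apply/eqnP; rewrite /= !mulr1n !addr0.
    by apply: w_inj; rewrite raddfD w00 w01 wf E0.
  - apply/eqnP; rewrite /= !mulr1n !add0r.
    by apply: w_inj; rewrite raddfD w10 w11 wf E1.
  - apply/eqnP; rewrite /= !mulr1n !addr0 !add0r.
    by apply: w_inj; rewrite raddfD w00 w10 wf E0'.
  - apply/eqnP; rewrite /= !mulr1n !add0r.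
    by apply: w_inj; rewrite raddfD w01 w11 wf E1'.
have {}sE I c : List.In (eqn I c) S -> c = s 0%N *+ I 0%N + (s 1%N *+ I 1%N +
      (s 2%N *+ I 2%N + s 3%N *+ I 3%N)).
  by move=> /sE/(eqnP M idfun).
exists (s 0%N), (s 1%N), (s 2%N), (s 3%N); split.
- by rewrite {1}(sE _ a0 (or_introl erefl)) /= !addr0.
- by rewrite {1}(sE _ a1 (or_intror (or_introl erefl))) /= !add0r.
- rewrite {1}(sE _ b0 (or_intror (or_intror (or_introl erefl)))) /=.
  by rewrite addr0 add0r.
- rewrite {1}(sE _ b1 (or_intror (or_intror (or_intror (or_introl erefl))))) /=.
  by rewrite !add0r.
Qed.

End Closed.

(** * Combination of the cancellative case and the group case *)

Theorem theorem3p9 (P : nat -> Prop)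
    (hP : multiplicative_subsemigroup P)
    (hP1 : ~ (forall p : nat, P p -> p = 1%N))
    (M : nmodType)
    (hM : simply_strongly_unitarily_closed P M) :
  quasi_divisible M /\ refinement_cone M.
Proof.
have [sM [cM tM] _] := hM; have [P0 _] := hP.
suff: quasi_divisible M /\ refinement M by case.
have [p [Pp p1]] : exists p, P p /\ (1 < p)%N.
  apply: contrapT => noP; apply: hP1 => p Pp.
  have := P0 p Pp; rewrite leq_eqVlt => /orP[/eqP //|p1].
  by case: noP; exists p.
have [addMI|[u [uM Mu]]] := simple_cone_cases Pp p1 sM cM tM.
  split; [exact: closed_quasi_divisible P0 hM addMI|].
  exact: closed_refinement P0 hM addMI.
split=> [x|].
  have [->|/eqP x0] := eqVneq x 0; first by exists 0, 0; rewrite !mul0rn addr0.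
  (* With x' the inverse of x, 2x' + 3x = 2u + x = x. *)
  have [x' xx'] := Mu x x0; exists x', x.
  rewrite [x *+ 3]mulrSr addrA -mulrnDl [x' + x]addrC xx' mulr2n.
  by rewrite -addrA !uM.
apply: refinement_nonzero => a0 a1 b0 b1 a00 a10 b00 b10 ab.
(* In a group c00 and c01 + c11 = b1 leave freedom: take c01 neutral, which forces c10 = b0 - a0 and
   c11 = b1. *)
have [a0' a0E] := Mu a0 a00; exists a0, u, (b0 + a0'), b1; split.
- by rewrite addrC uM.
- by rewrite addrAC -ab addrAC a0E uM.
- by rewrite addrCA a0E addrC uM.
- by rewrite uM.
Qed.
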